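(* Let $R$ be a ring and $\mathfrak{q}$ a two-sided completely prime ideal of $R$. Let $\mathcal{Q}_{\mathfrak{q}}(R)$ be the set of all quasi-orderings on $R$ with support $\mathfrak{q}$, and let $\leq$ be the coarsening relation. Then $(\mathcal{Q}_{\mathfrak{q}}(R),\leq)$ is a rooted tree.
   Context: Rings have a unit $1$ and are not necessarily commutative. A two-sided ideal $\mathfrak{q}\neq R$ is completely prime if $xy\in\mathfrak{q}$ implies $x\in\mathfrak{q}$ or $y\in\mathfrak{q}$. A quasi-ordering on a ring $R$ is a reflexive, transitive and total binary relation $\preceq$ on $R$ such that, writing $x\sim y$ if $x\preceq y$ and $y\preceq x$, $x\nsim y$ if not $x\sim y$, and $x\prec y$ if $x\preceq y$ but not $y\preceq x$, for all $a,b,x,y,z\in R$: (QR1) $0\prec 1$; (QR2) if $0\preceq a,b$ and $x\preceq y$, then $axb\preceq ayb$; (QR3) if $0\prec a,b$ and $axb\preceq ayb$, then $x\preceq y$; (QR4) if $z\nsim y$ and $x\preceq y$, then $x+z\preceq y+z$. Its support is $\{x\in R: x\sim 0\}$. Coarsening relation: for quasi-orderings $\preceq_1,\preceq_2$ on $R$, $\preceq_1\leq\preceq_2$ (read: $\preceq_2$ is coarser than $\preceq_1$) if for all $x,y\in R$: $0\preceq_1 x\preceq_1 y\Rightarrow x\preceq_2 y$. A partially ordered set $(S,\leq)$ is a tree if for all $s,s_1,s_2\in S$ with $s\leq s_1$ and $s\leq s_2$ one has $s_1\leq s_2$ or $s_2\leq s_1$. A rooted tree is a tree that admits a maximum. 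*)

(* Defs.v *)
From mathcomp Require Import all_boot all_algebra.
From mathcomp Require Import classical_sets.

Set Implicit Arguments.
Unset Strict Implicit.
Unset Printing Implicit Defensive.

Import GRing.Theory.

Local Open Scope classical_set_scope.
Local Open Scope ring_scope.

(* Rings are of type [pzRingType]: unital, possibly noncommutative, and the
   trivial ring is not excluded a priori. *)

Record two_sided_ideal (R : pzRingType) (q : set R) : Prop := TwoSidedIdeal {
  ideal0 : q 0;
  idealB : forall x y, q x -> q y -> q (x - y);
  idealMl : forall a x, q x -> q (a * x);
  idealMr : forall x a, q x -> q (x * a)
}.

Record completely_prime (R : pzRingType) (q : set R) : Prop := CompletelyPrime {
  cprime_ideal : two_sided_ideal q;
  cprime_proper : q <> setT;
  cprimeM : forall x y, q (x * y) -> q x \/ q y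
}.

Definition qo_sim (R : Type) (le : R -> R -> Prop) (x y : R) : Prop :=
  le x y /\ le y x.

Definition qo_lt (R : Type) (le : R -> R -> Prop) (x y : R) : Prop :=
  le x y /\ ~ le y x.

Record quasi_ordering (R : pzRingType) (le : R -> R -> Prop) : Prop :=
  QuasiOrdering {
    qo_refl : forall x, le x x;
    qo_trans : forall x y z, le x y -> le y z -> le x z;
    qo_total : forall x y, le x y \/ le y x;
    qo_lt01 : qo_lt le 0 1;
    qo_mul : forall a b x y,
      le 0 a -> le 0 b -> le x y -> le (a * x * b) (a * y * b);
    qo_cancel : forall a b x y,
      qo_lt le 0 a -> qo_lt le 0 b -> le (a * x * b) (a * y * b) -> le x y;
    qo_add : forall x y z, ~ qo_sim le z y -> le x y -> le (x + z) (y + z)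
  }.

Definition qo_support (R : pzRingType) (le : R -> R -> Prop) : set R :=
  [set x | qo_sim le x 0].

Definition quasi_orderings_with_support (R : pzRingType) (q : set R) :
    set (R -> R -> Prop) :=
  [set le | quasi_ordering le /\ qo_support le = q].

(* [coarsening le1 le2]: le2 is coarser than le1. *)
Definition coarsening (R : pzRingType) (le1 le2 : R -> R -> Prop) : Prop :=
  forall x y, le1 0 x -> le1 x y -> le2 x y.

Record partial_order_on (T : Type) (S : set T) (le : T -> T -> Prop) : Prop :=
  PartialOrderOn {
    po_refl : forall s, S s -> le s s;
    po_anti : forall s t, S s -> S t -> le s t -> le t s -> s = t;
    po_trans : forall s t u, S s -> S t -> S u -> le s t -> le t u -> le s u
  }.

Record tree_on (T : Type) (S : set T) (le : T -> T -> Prop) : Prop := TreeOn {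
  tree_po : partial_order_on S le;
  tree_comparable : forall s s1 s2, S s -> S s1 -> S s2 ->
    le s s1 -> le s s2 -> le s1 s2 \/ le s2 s1
}.

Definition rooted_tree_on (T : Type) (S : set T) (le : T -> T -> Prop) : Prop :=
  tree_on S le /\ exists2 m, S m & forall s, S s -> le s m.

(* Main.v *)
Require Import Defs.
From mathcomp Require Import all_boot all_algebra.
From mathcomp Require Import classical_sets boolp.

Import GRing.Theory.

(** Write [x ~ y] for [qo_sim le x y].  Everything rests on a dichotomy, decided
    by the sign of [-1].

    If [0 <= -1], the quasi-ordering behaves like a valuation ([x <= y] meaning
    v(x) >= v(y)): every element is nonnegative and [x ~ - x].  Otherwise it is
    an ordering: [x <= y] iff [0 <= y - x], so it is determined by its
    nonnegative elements, and one of [x], [- x] is nonnegative, both of them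
    only when [x ~ 0] ([qo_all_ge0], [qo_sim_opp], [qo_leP], [qo_antisym0]).

    A coarsening preserves nonnegativity.  Hence mutual coarsenings have the
    same nonnegative elements, so they are of the same type, and they are equal
    ([coarsening_antisym]).

    Let [s] be finer than [s1] and [s2].  If [s1] is an ordering, then so is
    [s], and the nonnegative elements of [s] are exactly those of [s1]; thus [s1]
    relates no more elements than [s] and is finer than [s2]
    ([coarsening_order]).  If [s1] and [s2] are both of valuation type and
    incomparable, take [x <=1 y], [y <2 x] and [u <=2 v], [v <1 u].  Up to signs
    all four are nonnegative for [s], so [y <=s x] and [v <=s u], and therefore
    [x ~1 y] and [u ~2 v].  Now compare [y * u] and [x * v] for [s]:
    since [y * u ~2 y * v <2 x * v] and [x * v ~1 y * v <1 y * u], the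
    comparison is strict both ways, which is absurd
    ([coarsening_comparable_val]).  The strict steps cancel [v] and [y], which
    lie outside the common support.  This product trick stands in for the fact
    that the convex subgroups of an ordered value group form a chain.

    The root is the trivial valuation with support [q]. *)

Local Open Scope classical_set_scope.
Local Open Scope ring_scope.

(** * The sign dichotomy *)

Section QuasiOrdering.
Context {R : pzRingType} {le : R -> R -> Prop} (Hle : quasi_ordering le).
Implicit Types a x y z : R.

Let le_trans := qo_trans Hle.

Lemma qo_nle_lt {x y} : ~ le x y -> qo_lt le y x.
Proof. by move=> nxy; split=> //; case: (qo_total Hle x y). Qed.

Lemma qo_simC {x y} : qo_sim le x y -> qo_sim le y x.
Proof. by case. Qed.

Lemma qo_sim_trans {y x z} :
  qo_sim le x y -> qo_sim le y z -> qo_sim le x z.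
Proof. by move=> [xy yx] [yz zy]; split; apply: le_trans; eauto. Qed.

(** If [- x] were not null, then neither [x] nor [0] would be equivalent to it,
    so it could be added to both inequalities between them, which makes it
    null. *)
Lemma qo_opp_sim0 {x} : qo_sim le x 0 -> qo_sim le (- x) 0.
Proof.
move=> x0; apply: contrapT => nx0; apply: (nx0).
have nxx : ~ qo_sim le (- x) x.
  by move=> xx; apply: nx0; apply: qo_sim_trans xx x0.
have [lx0 l0x] := x0; split.
- by have := qo_add Hle nxx l0x; rewrite add0r subrr.
- by have := qo_add Hle nx0 lx0; rewrite subrr add0r.
Qed.

Lemma qo_opp_ge0 {x} : le x 0 -> le 0 (- x).
Proof.
move=> x0; case: (pselect (qo_sim le (- x) 0)) => [[]//|nx0].
by have := qo_add Hle nx0 x0; rewrite subrr add0r.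
Qed.

Lemma qo_ge0_or_opp x : le 0 x \/ le 0 (- x).
Proof. by case: (qo_total Hle 0 x); [left | move/qo_opp_ge0; right]. Qed.

Lemma qo_addr_sim0_nsim {x s} :
  qo_sim le s 0 -> ~ qo_sim le x 0 -> qo_sim le (x + s) x.
Proof.
move=> s0 nx0; have [ls0 l0s] := s0; split; rewrite addrC.
  by have := qo_add Hle nx0 ls0; rewrite add0r.
have nxs : ~ qo_sim le x s by move=> xs; apply: nx0; apply: qo_sim_trans xs s0.
by have := qo_add Hle nxs l0s; rewrite add0r.
Qed.

(** When [x ~ 0] as well, [x + s] cannot escape the support: otherwise
    subtracting [x] would leave its class unchanged, but it yields [s]. *)
Lemma qo_addr_sim0 {x s} : qo_sim le s 0 -> qo_sim le (x + s) x.
Proof.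
move=> s0; case: (pselect (qo_sim le x 0)) => [x0|]; last first.
  exact: qo_addr_sim0_nsim.
suff xs0 : qo_sim le (x + s) 0 by apply: qo_sim_trans xs0 (qo_simC x0).
apply: contrapT => nxs0; apply: (nxs0).
have := qo_addr_sim0_nsim (qo_opp_sim0 x0) nxs0.
rewrite addrAC subrr add0r => /qo_simC sx.
exact: qo_sim_trans sx s0.
Qed.

Lemma qo_mull {a x y} : le 0 a -> le x y -> le (a * x) (a * y).
Proof.
move=> a0 xy; have := qo_mul Hle a0 (proj1 (qo_lt01 Hle)) xy.
by rewrite !mulr1.
Qed.

Lemma qo_mulr {a x y} : le 0 a -> le x y -> le (x * a) (y * a).
Proof.
move=> a0 xy; have := qo_mul Hle (proj1 (qo_lt01 Hle)) a0 xy.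
by rewrite !mul1r.
Qed.

Lemma qo_cancell {a x y} : qo_lt le 0 a -> le (a * x) (a * y) -> le x y.
Proof.
move=> a0 xy; apply: (qo_cancel Hle a0 (qo_lt01 Hle)).
by rewrite !mulr1.
Qed.

Lemma qo_cancelr {a x y} : qo_lt le 0 a -> le (x * a) (y * a) -> le x y.
Proof.
move=> a0 xy; apply: (qo_cancel Hle (qo_lt01 Hle) a0).
by rewrite !mul1r.
Qed.

(** ** Valuation type *)

(** Multiplying [x <= 0] by [-1] gives [- x <= 0], while subtracting [x] from it
    gives [0 <= - x]: a nonpositive element lies in the support. *)
Lemma qo_all_ge0 (N1 : le 0 (-1)) x : le 0 x.
Proof.
case: (qo_total Hle 0 x) => // x0.
have := qo_mull N1 x0; rewrite mulr0 mulN1r => nx0.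
have : qo_sim le (- x) 0 by split=> //; apply: qo_opp_ge0.
by move/qo_opp_sim0; rewrite opprK => -[].
Qed.

Lemma qo_sim_opp (N1 : le 0 (-1)) x : qo_sim le x (- x).
Proof.
have : qo_sim le 1 (-1).
  (* Whichever of the two inequalities holds, multiplying it by [-1] gives the
     other one. *)
  by case: (qo_total Hle 1 (-1)) => h; split=> //;
    have := qo_mull N1 h; rewrite !mulN1r opprK.
case=> h1 h2; have x0 := qo_all_ge0 N1 x.
have := qo_mull x0 h1; have := qo_mull x0 h2.
by rewrite mulrN1 mulr1; split.
Qed.

(** ** Ordering type *)

Section OrderType.
Hypothesis N1 : ~ le 0 (-1).

Lemma qo_opp_le0 {x} : le 0 x -> le (- x) 0.
Proof.
move=> x0; have [n1 _] := qo_nle_lt N1.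
by have := qo_mull x0 n1; rewrite mulr0 mulrN1.
Qed.

Lemma qo_antisym0 {x} : le 0 x -> le 0 (- x) -> qo_sim le x 0.
Proof. by move=> x0 /qo_opp_le0; rewrite opprK. Qed.

(** Outside the support, [y] and [- y] have opposite signs; so they are not
    equivalent, and the translation axiom allows one to subtract [y].  If [y]
    lies in the support, both sides say that [x <= 0]. *)
Lemma qo_leP {x y} : le x y <-> le 0 (y - x).
Proof.
have -> : le 0 (y - x) <-> le (x - y) 0.
  by rewrite -(opprB x y); split=> [/qo_opp_le0|/qo_opp_ge0]; rewrite ?opprK.
case: (pselect (qo_sim le y 0)) => [y0|ny0].
  have [xy1 xy2] := qo_addr_sim0 (x := x) (qo_opp_sim0 y0).
  case: y0 => y0 y0'; split=> h; first by do 2![apply: le_trans; eauto].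
  by apply: le_trans xy2 _; apply: le_trans h _.
split=> h.
  have nyy : ~ qo_sim le (- y) y.
    move=> [yy yy']; apply: ny0; case: (qo_total Hle 0 y) => y0.
      by apply: qo_antisym0 => //; apply: le_trans y0 yy'.
    by apply: qo_antisym0; [apply: le_trans (qo_opp_ge0 y0) yy
                          | exact: qo_opp_ge0].
  by have := qo_add Hle nyy h; rewrite subrr.
by have := qo_add Hle ny0 h; rewrite subrK add0r.
Qed.

End OrderType.

End QuasiOrdering.

(** * Coarsenings *)

Section Coarsening.
Context {R : pzRingType}.
Implicit Types (s : R -> R -> Prop) (x y : R).

Lemma coarsening_ge0 {s1 s2 x} : quasi_ordering s1 ->
  coarsening s1 s2 -> s1 0 x -> s2 0 x.
Proof. by move=> H1 c x0; apply: c x0; apply: (qo_refl H1). Qed.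

Lemma coarsening_trans {s1 s2 s3} : quasi_ordering s1 ->
  coarsening s1 s2 -> coarsening s2 s3 -> coarsening s1 s3.
Proof.
move=> H1 c12 c23 x y x0 xy.
by apply: c23; [apply: (coarsening_ge0 H1 c12) | apply: c12].
Qed.

Lemma coarsening_antisym s1 s2 : quasi_ordering s1 -> quasi_ordering s2 ->
  coarsening s1 s2 -> coarsening s2 s1 -> s1 = s2.
Proof.
move=> H1 H2 c12 c21.
have ge0E x : s1 0 x <-> s2 0 x.
  by split; [apply: (coarsening_ge0 H1 c12) | apply: (coarsening_ge0 H2 c21)].
apply/funext => x; apply/funext => y; apply/propext.
case: (pselect (s1 0 (-1))) => N1.
  have N2 := (ge0E _).1 N1.
  by split=> [/c12|/c21]; apply; apply: qo_all_ge0.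
have N2 : ~ s2 0 (-1) by move/ge0E.
by rewrite (qo_leP H1 N1) (qo_leP H2 N2).
Qed.

(** An ordering admits no proper refinement with the same support.  Suppose
    that [0 <=1 z] but not [0 <=s z].  Then [- z] is nonnegative for [s], hence
    for [s1], so [z] lies in the common support: a contradiction. *)
Lemma coarsening_order s s1 :
  quasi_ordering s -> quasi_ordering s1 -> qo_support s = qo_support s1 ->
  coarsening s s1 -> ~ s1 0 (-1) -> forall x y, s1 x y -> s x y.
Proof.
move=> H H1 supp c N1 x y /(qo_leP H1 N1) yx0.
have N : ~ s 0 (-1) by move/(coarsening_ge0 H c).
apply/(qo_leP H N); case: (qo_ge0_or_opp H (y - x)) => // opp0.
have : qo_support s1 (y - x).
  exact: (qo_antisym0 H1 N1 yx0 (coarsening_ge0 H c opp0)).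
by rewrite -supp => -[].
Qed.

(** The elements are chosen nonnegative for [s] so that comparisons in [s] pass
    to the coarser relations; that [y] is not null makes it cancellable. *)
Lemma ncoarsening_witness s s1 s2 :
  quasi_ordering s -> quasi_ordering s1 -> quasi_ordering s2 ->
  coarsening s s1 -> coarsening s s2 -> s1 0 (-1) -> s2 0 (-1) ->
  qo_support s1 = qo_support s2 -> ~ coarsening s1 s2 ->
  exists x y, [/\ s 0 x, qo_lt s1 0 y /\ s 0 y, qo_sim s1 x y & qo_lt s2 y x].
Proof.
move=> H H1 H2 c1 c2 N1 N2 supp /existsNP[x] /existsNP[y].
move=> /not_implyP[_ /not_implyP[xy nxy]].
have normalize z : exists2 z', s 0 z' & qo_sim s1 z z' /\ qo_sim s2 z z'.
  case: (qo_ge0_or_opp H z) => z0; [exists z | exists (- z)] => //.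
    by do 2!split; [apply: (qo_refl H1) | apply: (qo_refl H1)
                   | apply: (qo_refl H2) | apply: (qo_refl H2)].
  by split; apply: qo_sim_opp.
have [x' x0 [[_ x1] [x2 _]]] := normalize x.
have [y' y0 [[y1 _] [_ y2]]] := normalize y.
have xy' : s1 x' y' := qo_trans H1 (qo_trans H1 x1 xy) y1.
have nxy' : ~ s2 x' y'.
  by move=> h; apply: nxy; exact: (qo_trans H2 (qo_trans H2 x2 h) y2).
have yx' : s1 y' x'.
  apply: c1 y0 _; case: (qo_total H x' y') => // h.
  by case: nxy'; apply: c2.
exists x', y'; split=> //; last exact: (qo_nle_lt H2 nxy').
split=> //; apply: (qo_nle_lt H1) => y10; apply: nxy'.
(* If [y' ~1 0], then [x'] is in the common support, so [x' <=2 0 <=2 y']. *)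
have : qo_support s1 x' by split; [apply: (qo_trans H1) y10
                                  | apply: (coarsening_ge0 H c1)].
rewrite supp => -[x20 _].
by apply: (qo_trans H2) x20 _; apply: (coarsening_ge0 H c2).
Qed.

Lemma coarsening_comparable_val s s1 s2 :
  quasi_ordering s -> quasi_ordering s1 -> quasi_ordering s2 ->
  coarsening s s1 -> coarsening s s2 -> s1 0 (-1) -> s2 0 (-1) ->
  qo_support s1 = qo_support s2 ->
  coarsening s1 s2 \/ coarsening s2 s1.
Proof.
move=> H H1 H2 c1 c2 N1 N2 supp; apply: contrapT => /not_orP[n12 n21].
have [x [y [x0 [ygt0 y0] [xy1 _] [_ nxy2]]]] :=
  (ncoarsening_witness _ _ _ H H1 H2 c1 c2 N1 N2 supp n12).
have [u [v [u0 [vgt0 v0] [uv2 _] [_ nuv1]]]] :=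
  (ncoarsening_witness _ _ _ H H2 H1 c2 c1 N2 N1 (esym supp) n21).
have mul0 a b : s 0 a -> s 0 b -> s 0 (a * b).
  by move=> a0 /(qo_mull H a0); rewrite mulr0.
case: (qo_total H (x * v) (y * u)) => h.
  have {}h := c2 _ _ (mul0 _ _ x0 v0) h.
  apply: nxy2; apply: (qo_cancelr H2 vgt0).
  exact: (qo_trans H2 h (qo_mull H2 (qo_all_ge0 H2 N2 y) uv2)).
have {}h := c1 _ _ (mul0 _ _ y0 u0) h.
apply: nuv1; apply: (qo_cancell H1 ygt0).
exact: (qo_trans H1 h (qo_mulr H1 (qo_all_ge0 H1 N1 v) xy1)).
Qed.

Lemma coarsening_comparable s s1 s2 :
  quasi_ordering s -> quasi_ordering s1 -> quasi_ordering s2 ->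
  qo_support s = qo_support s1 -> qo_support s = qo_support s2 ->
  coarsening s s1 -> coarsening s s2 ->
  coarsening s1 s2 \/ coarsening s2 s1.
Proof.
move=> H H1 H2 supp1 supp2 c1 c2.
case: (pselect (s1 0 (-1))) => N1; last first.
  left=> x y x0 xy.
  by apply: c2; apply: (coarsening_order _ _ H H1 supp1 c1 N1).
case: (pselect (s2 0 (-1))) => N2; last first.
  right=> x y x0 xy.
  by apply: c1; apply: (coarsening_order _ _ H H2 supp2 c2 N2).
apply: (coarsening_comparable_val _ _ _ H) => //.
by rewrite -supp1.
Qed.

End Coarsening.

(** * The trivial valuation *)

Section TrivialValuation.
Context {R : pzRingType} {q : set R} (hq : completely_prime q).
Implicit Types x y : R.

(** The valuation with values 0 off [q] and infinity on [q]. *)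
Definition trivial_qo (q : set R) x y : Prop := q y -> q x.

Let q_ideal := cprime_ideal hq.
Let q0 := ideal0 q_ideal.

Lemma cprime1 : ~ q 1.
Proof.
move=> q1; apply: (cprime_proper hq); apply/seteqP; split=> // x _.
by rewrite -(mulr1 x); apply: (idealMl q_ideal).
Qed.

Lemma trivial_qoP : quasi_ordering (trivial_qo q).
Proof.
have qD x y : q x -> q y -> q (x + y).
  move=> qx qy; rewrite -(opprK y) -(sub0r y).
  by apply: (idealB q_ideal) => //; apply: (idealB q_ideal).
split=> /=.
- by move=> x.
- by move=> x y z xy yz /yz.
- move=> x y; case: (pselect (q x)) => qx; first by left.
  by right.
- by split=> [_|h]; [|apply: cprime1; apply: h].
- move=> a b x y a0 b0 xy /(cprimeM hq)[/(cprimeM hq)[qa|/xy qx]|qb].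
  + by do 2!apply: (Defs.idealMr q_ideal).
  + by apply: (Defs.idealMr q_ideal); apply: (idealMl q_ideal).
  + exact: (idealMl q_ideal).
- move=> a b x y [_ na] [_ nb] h qy.
  case: (cprimeM hq (h _)) => [|/(cprimeM hq)[qa|//]|qb].
  + by apply: (Defs.idealMr q_ideal); apply: (idealMl q_ideal).
  + by case: na.
  + by case: nb.
- move=> x y z nzy xy qyz; case: (pselect (q y)) => qy.
    have qz : q z by rewrite -(addrK y z) [z + y]addrC; apply: (idealB q_ideal).
    by apply: qD => //; apply: xy.
  case: nzy; split=> // qz; case: qy.
  by rewrite -(addrK z y); apply: (idealB q_ideal).
Qed.

Lemma trivial_qo_support : qo_support (trivial_qo q) = q.
Proof. by apply/seteqP; split=> x; [case=> + _; apply | split]. Qed.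

Lemma coarsening_trivial le : qo_support le = q -> quasi_ordering le ->
  coarsening le (trivial_qo q).
Proof.
move=> <- H x y x0 xy [y0 _].
by split=> //; apply: (qo_trans H) xy y0.
Qed.

End TrivialValuation.

Theorem theorem5p9 (R : pzRingType) (q : set R) (hq : completely_prime q) :
  rooted_tree_on (quasi_orderings_with_support q) (@coarsening R).
Proof.
split; last first.
  exists (trivial_qo q).
    by split; [apply: trivial_qoP | apply: trivial_qo_support].
  by move=> s [H supp]; apply: coarsening_trivial.
split.
- split.
  + by move=> s _ x y.
  + by move=> s t [Hs _] [Ht _]; apply: coarsening_antisym.
  + by move=> s t u [Hs _] _ _; apply: coarsening_trans.
- move=> s s1 s2 [H supp] [H1 supp1] [H2 supp2].
  by apply: (coarsening_comparable _ _ _ H) => //; rewrite supp.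
Qed.
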